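(* Let $A$ be a finite alphabet, let $\phi: A^* \to A^*$ be a non-erasing morphism, and let $w \in A^{\mathbf{N}}$ be a pure morphic word generated by $\phi$, i.e. there exist a letter $b \in A$ and a nonempty word $u \in A^*$ with $\phi(b) = bu$ and $w = \lim_{i\to\infty} \phi^i(b)$ (so that $\phi(w) = w$). If for every letter $a \in A$ the frequency of $a$ in $w$ exists, then for every finite word $v \in A^*$ that is a factor of $w$, the frequency of $v$ in $w$ exists.
   Context: For an infinite word $w = w[1]w[2]w[3]\cdots$ and a finite nonempty word $v$ of length $k$, the (ordinary) frequency of $v$ in $w$ is $$\lim_{n\to\infty} \frac{\#\{ i : 1 \le i \le n,\ w[i]w[i+1]\cdots w[i+k-1] = v\}}{n},$$ if this limit exists. A morphism $\phi: A^*\to A^*$ is a monoid homomorphism of the free monoid; it is non-erasing if $\phi(a)$ is nonempty for every $a\in A$. A factor of $w$ is a finite word of the form $w[t]w[t+1]\cdots w[r]$ with $1\le t\le r$. *)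

(* Defs.v *)
From mathcomp Require Import all_boot.
From Stdlib Require Import Reals.
Set Implicit Arguments. Unset Strict Implicit. Unset Printing Implicit Defensive.

(* Finite words are [seq A]; infinite words are [nat -> A], indexed from 0
   (w 0 is the paper's w[1]). A morphism A^* -> A^* is determined by its
   values on letters: [phi : A -> seq A], extended by [morph_ext]. *)
Definition morph_ext (A : Type) (phi : A -> seq A) (s : seq A) : seq A :=
  flatten (map phi s).

Definition non_erasing (A : Type) (phi : A -> seq A) : Prop :=
  forall a, 0 < size (phi a).

Definition is_limit_of_iterates (A : Type) (phi : A -> seq A) (b : A)
    (w : nat -> A) : Prop :=
  forall i n, n < size (iter i (morph_ext phi) [:: b]) ->
    w n = nth b (iter i (morph_ext phi) [:: b]) n.

Definition occurs_at (A : eqType) (w : nat -> A) (v : seq A) (i : nat) : bool :=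
  all (fun j => w (i + j) == nth (w i) v j) (iota 0 (size v)).

Definition occ_count (A : eqType) (w : nat -> A) (v : seq A) (n : nat) : nat :=
  count (occurs_at w v) (iota 0 n).

Definition freq_exists (A : eqType) (w : nat -> A) (v : seq A) : Prop :=
  exists l : R, Un_cv (fun n => (INR (occ_count w v n) / INR n)%R) l.

Definition is_factor (A : eqType) (w : nat -> A) (v : seq A) : Prop :=
  0 < size v /\ exists t, occurs_at w v t.

(* Main.v *)
Require Import Defs.
From Stdlib Require Import Reals.
From mathcomp Require Import all_boot all_order all_algebra.
From mathcomp Require Import boolp classical_sets reals topology normedtype
  sequences Rstruct ring lra zify.
Set Implicit Arguments. Unset Strict Implicit. Unset Printing Implicit Defensive.
Import Order.TTheory GRing.Theory Num.Theory numFieldNormedType.Exports.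

(* Let [S n] be the length of [phi] applied to the prefix of [w] of length [n].
   Since [phi w = w], the word [phi^m (w i)] sits in [w] at the positions
   between [S^m i] and [S^m (i + 1)]. The letter frequencies give
   [S n / n --> lam], hence [S^m n / n --> lam ^ m], with [lam >= 1].
   - If [lam > 1], cut [w] into the blocks [phi^m (w i)]. Up to an error of
     [size v] per block, the number of occurrences of [v] in a block depends
     only on the letter [w i]; the blocks have mean length [lam ^ m], so the
     density of [v] is within [O(size v / lam ^ m)] of a limit, for every [m].
   - If [lam = 1], pass to the word [W] of windows of length [size v]: the
     windows starting in the [i]-th block depend only on [W i]. Growth is
     subexponential, so no window can return twice to itself within one
     block. After replacing [S] by a power the return relation is therefore
     triangular with diagonal entries at most [1], and the number of
     occurrences of each window in the [n]-th iterate of a block is equivalent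
     to a multiple of some binomial [C(n, d)]. This gives the density along the
     lengths [L n] of the iterates of [b], and [L (n + 1) / L n --> 1] extends
     it to all prefixes. *)

(** * Iterates of strictly increasing maps and sums over blocks *)

Lemma leq_homo_iter (S : nat -> nat) m :
  (forall i, S i < S i.+1) -> {homo iter m S : i j / i <= j}.
Proof.
move=> S_lt i j ij; elim: m => //= m IHm.
by apply: (homo_leq (@leqnn) (@leq_trans)) IHm => k; apply: ltnW.
Qed.

Lemma ltn_homo_iter (S : nat -> nat) m :
  (forall i, S i < S i.+1) -> {homo iter m S : i j / i < j}.
Proof.
move=> S_lt i j ij; elim: m => //= m IHm.
by apply: (homo_ltn (@ltn_trans)) IHm.
Qed.

Lemma leq_iter_id (S : nat -> nat) m i :
  (forall i, S i < S i.+1) -> i <= iter m S i.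
Proof.
move=> S_lt; elim: i => [//|i IHi].
exact: leq_ltn_trans IHi (ltn_homo_iter m S_lt (ltnSn i)).
Qed.

Lemma big_nat_blocks (s f : nat -> nat) a c :
  {homo s : i j / i <= j} -> a <= c ->
  \sum_(s a <= j < s c) f j = \sum_(a <= i < c) \sum_(s i <= j < s i.+1) f j.
Proof.
move=> s_le; elim: c => [|c IHc].
  by rewrite leqn0 => /eqP ->; rewrite !big_geq.
rewrite leq_eqVlt => /predU1P[<-|]; first by rewrite !big_geq.
rewrite ltnS => ac; rewrite big_nat_recr //= -IHc //.
by rewrite (big_cat_nat (n := s c)) // s_le.
Qed.

(** Bernoulli's inequality for [4 / 3], which is [H], taken at the exponent [3 * c]. *)
Lemma exp4_not_le_mul_exp3 c : ~ (forall n, 4 ^ n <= 3 ^ n * c).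
Proof.
have H n : (3 + n) * 3 ^ n <= 3 * 4 ^ n.
  elim: n => // n IHn; rewrite !expnS; nia.
move=> /(_ (3 * c)); have := H (3 * c).
have : 0 < 3 ^ (3 * c) by rewrite expn_gt0.
nia.
Qed.

(** * Iterated blocks *)

Section Blocks.
Context (T : finType) (W : nat -> T) (S : nat -> nat).
Hypothesis S_lt : forall i, S i < S i.+1.
(** Quantifying over [f] expresses that [W i] determines the multiset of letters in its [m]-fold
    block. *)
Hypothesis S_det : forall i j, W i = W j -> forall m (f : T -> nat),
  \sum_(iter m S i <= k < iter m S i.+1) f (W k) =
  \sum_(iter m S j <= k < iter m S j.+1) f (W k).

(** An entry of the [m]-th power of the incidence matrix; rows are indexed by positions [i] rather
    than letters, so that letters absent from [W] need no row. *)
Definition block_count m i v : nat :=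
  \sum_(iter m S i <= j < iter m S i.+1) (W j == v).

Lemma block_count0 i v : block_count 0 i v = (W i == v).
Proof. by rewrite /block_count /= big_nat1. Qed.

(** The product rule for powers of the incidence matrix. *)
Lemma block_countD m n i v :
  block_count (m + n) i v =
  \sum_(iter n S i <= j < iter n S i.+1) block_count m j v.
Proof.
rewrite /block_count !iterD big_nat_blocks //; first exact: leq_homo_iter.
exact: leq_homo_iter.
Qed.

Lemma block_count_eq m i j v : W i = W j -> block_count m i v = block_count m j v.
Proof. by move=> ij; apply: (S_det ij m (fun x => nat_of_bool (x == v))). Qed.

Lemma sum_block_count m i :
  \sum_v block_count m i v = iter m S i.+1 - iter m S i.
Proof.
rewrite /block_count exchange_big /= -[RHS]muln1 -sum_nat_const_nat.
apply: eq_bigr => j _; rewrite (bigD1 (W j)) //= eqxx big1 // => v.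
by rewrite eq_sym => /negbTE ->.
Qed.

Lemma block_count_gt0P m i v :
  reflect (exists2 j, iter m S i <= j < iter m S i.+1 & W j = v)
          (0 < block_count m i v).
Proof.
rewrite lt0n /block_count sum_nat_seq_neq0; apply: (iffP hasP) => [[j]|[j]].
  by rewrite mem_index_iota => ij /=; rewrite eqb0 negbK => /eqP; exists j.
move=> ij Wj; exists j; first by rewrite mem_index_iota.
by rewrite /= Wj eqxx.
Qed.

Lemma leq_block_count_trans m n i j v : 0 < block_count n i (W j) ->
  block_count m j v <= block_count (m + n) i v.
Proof.
case/block_count_gt0P => k /andP[ik ki] Wk; rewrite block_countD.
rewrite (big_cat_nat (n := k)) ?(ltnW ki) //= [X in _ + X]big_ltn //.
by rewrite (block_count_eq _ _ Wk); lia.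
Qed.

Lemma block_count_trans m n i j v : 0 < block_count n i (W j) ->
  0 < block_count m j v -> 0 < block_count (m + n) i v.
Proof. by move=> /leq_block_count_trans H /leq_trans; apply. Qed.

(** Each return to [W i] within a [t]-block brings its own copy of all later returns. *)
Lemma block_count_exp t n i :
  block_count t i (W i) ^ n <= block_count (n * t) i (W i).
Proof.
elim: n => [|n IHn]; first by rewrite mul0n block_count0 eqxx.
rewrite mulSnr block_countD expnS {1}/block_count big_distrl /=.
apply: leq_sum => j _; case: eqP => [Wj|]; last by rewrite mul0n.
by rewrite mul1n (block_count_eq _ _ Wj).
Qed.

Lemma block_count_cycle t n i :
  0 < block_count t i (W i) -> 0 < block_count (n * t) i (W i).
Proof. by move=> c; apply: leq_trans (block_count_exp t n i); rewrite expn_gt0 c. Qed.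

(* Two returns to [W i] within one [t]-block would force
   [iter (n * t) S i.+1 >= 2 ^ n]. *)
Lemma block_count_le1 t K : (forall n, 2 * iter t S n <= 3 * n + K) ->
  forall i, block_count t i (W i) <= 1.
Proof.
move=> St i; rewrite leqNgt; apply/negP => c2.
apply: (@exp4_not_le_mul_exp3 (i.+1 + K)) => n.
have lb : 2 ^ n <= iter (n * t) S i.+1.
  apply: leq_trans (_ : _ <= \sum_v block_count (n * t) i v) _; last first.
    by rewrite sum_block_count leq_subr.
  rewrite (bigD1 (W i)) //= -[2 ^ n]addn0 leq_add //.
  by apply: leq_trans (block_count_exp t n i); case: n => // n; rewrite leq_exp2r.
have ub : 2 ^ n * (iter (n * t) S i.+1 + K) <= 3 ^ n * (i.+1 + K).
  elim: n {lb} => [|n IHn]; first by rewrite mul0n.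
  by rewrite mulSn iterD !expnS; have := St (iter (n * t) S i.+1); nia.
apply: leq_trans ub; rewrite -[4]/(2 * 2) expnMn leq_mul2l expn_eq0 /=.
exact: leq_trans lb (leq_addr _ _).
Qed.

(** Choose one return time per letter, and [1] for letters that never return. Their product over the
    finite alphabet is a multiple of each, and multiples of a return time are return times. *)
Lemma recurrence_period : exists2 p, 0 < p & forall i t, 0 < t ->
  0 < block_count t i (W i) -> 0 < block_count p i (W i).
Proof.
have /choice[t tP] : forall x : T, exists t, 0 < t /\
    forall i s, W i = x -> 0 < s -> 0 < block_count s i x -> 0 < block_count t i x.
  move=> x; have [[i [s [<- s_gt0 ixs]]]|nox] := pselect (exists i s,
      [/\ W i = x, 0 < s & 0 < block_count s i x]).
    by exists s; split=> // j _ Wj _ _; rewrite (block_count_eq _ _ Wj).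
  by exists 1; split=> // i s Wi s_gt0 c; case: nox; exists i, s.
exists (\prod_x t x); first by rewrite prodn_gt0 // => x; case: (tP x).
move=> i s s_gt0 c; rewrite (bigD1 (W i)) //= mulnC block_count_cycle //.
by case: (tP (W i)) => _ /(_ i s); apply.
Qed.

End Blocks.

(** * Growth comparable to a binomial coefficient *)

Section BinomialGrowth.
Local Open Scope ring_scope.
Local Open Scope classical_set_scope.
Context {R : realType}.

Lemma cvgn_near (u v : nat -> R) (l : R) :
  (\forall n \near \oo, u n = v n) -> u @ \oo --> l -> v @ \oo --> l.
Proof. by move=> uv; apply: cvg_trans; apply: near_eq_cvg. Qed.

Lemma stolz_cesaro (F B : nat -> R) (l : R) :
  B @ \oo --> +oo ->
  (forall e, 0 < e -> \forall n \near \oo,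
    `|F n.+1 - F n - l * (B n.+1 - B n)| <= e * (B n.+1 - B n)) ->
  (fun n => F n / B n) @ \oo --> l.
Proof.
move=> By FB; apply/cvgrPdist_le => e e0.
have Bgt := (cvgryPgt B).1 By; have Bge := (cvgryPge B).1 By.
have e20 : 0 < e / 2 by lra.
have [N _ NP] := FB _ e20.
have bound n : (N <= n)%N ->
    `|F n - l * B n - (F N - l * B N)| <= e / 2 * (B n - B N).
  elim: n => [|n IHn]; first by rewrite leqn0 => /eqP ->; rewrite !subrr mulr0 normr0.
  rewrite leq_eqVlt => /predU1P[<-|]; first by rewrite !subrr mulr0 normr0.
  rewrite ltnS => Nn; have := IHn Nn; have := NP _ Nn.
  rewrite !ler_norml => /andP[? ?] /andP[? ?].
  by apply/andP; split; nra.
near=> n.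
have Bn1 : 0 < B n by near: n; apply: Bgt.
have Bn2 : `|F N - l * B N| - e / 2 * B N <= e / 2 * B n.
  by rewrite -ler_pdivrMl //; near: n; apply: Bge.
have Nn : (N <= n)%N by near: n; exists N.
have -> : l - F n / B n = (l * B n - F n) / B n by field; rewrite gt_eqF.
rewrite normrM normfV (gtr0_norm Bn1) ler_pdivrMr //.
have := bound _ Nn; rewrite !ler_norml => /andP[? ?].
have := ler_norm (F N - l * B N); have := ler_norm (- (F N - l * B N)); rewrite normrN.
by move=> ? ?; apply/andP; split; lra.
Unshelve. all: by end_near. Qed.

(** Binomials are preferred to powers of [n] because Pascal's rule makes [binR d] the exact
    increment of [binR d.+1]: summation raises the degree and keeps the leading coefficient. *)
Definition binR (d n : nat) : R := 'C(n, d)%:R.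

Lemma binR_gt0 d n : (d <= n)%N -> 0 < binR d n.
Proof. by move=> ?; rewrite /binR ltr0n bin_gt0. Qed.

(** At [n + d.+1] the quotient is exactly [d.+1 / n.+1]. *)
Lemma binR_div_next d : (fun n => binR d n / binR d.+1 n) @ \oo --> (0 : R).
Proof.
rewrite -(cvg_shiftn d.+1).
apply: (@cvgn_near (fun n => d.+1%:R * n.+1%:R^-1)); last first.
  rewrite -[X in _ --> X](mulr0 (d.+1%:R)).
  by apply: cvgMl_tmp; apply: cvg_harmonic.
near=> n; have := mul_bin_left (n + d.+1) d.
have -> : (n + d.+1 - d = n.+1)%N by lia.
move=> /(congr1 (fun k => k%:R : R)); rewrite !natrM -/(binR _ _) -/(binR _ _) => E.
have := @binR_gt0 d.+1 (n + d.+1) (leq_addl _ _) => ?.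
have ? : 0 < n.+1%:R :> R by rewrite ltr0n.
apply: (mulfI (lt0r_neq0 (_ : 0 < n.+1%:R :> R))) => //.
rewrite [RHS]mulrA -E.
by rewrite mulfK ?gt_eqF // mulrC mulfVK ?gt_eqF.
Unshelve. all: by end_near. Qed.

Lemma binR_div_succ d : (fun n => binR d n / binR d n.+1) @ \oo --> (1 : R).
Proof.
case: d => [|d].
  rewrite [X in X @ _](_ : _ = fun=> 1); first exact: cvg_cst.
  by apply/funext => n; rewrite /binR !bin0 divr1.
apply: (@cvgn_near (fun n => (1 + binR d n / binR d.+1 n)^-1)).
  near=> n; have dn : (d.+1 <= n)%N by near: n; exists d.+1.
  have := @binR_gt0 d.+1 n dn; have := @binR_gt0 d n (ltnW dn).
  rewrite [X in _ = _ / X](_ : _ = binR d.+1 n + binR d n); last by rewrite /binR binS natrD.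
  move: (binR d n) (binR d.+1 n) => x y *; field.
  by rewrite !gt_eqF // addr_gt0.
rewrite -[X in _ --> X]invr1; apply: cvgV; first by rewrite oner_eq0.
rewrite -[X in _ --> X]addr0; apply: cvgD; first exact: cvg_cst.
exact: binR_div_next.
Unshelve. all: by end_near. Qed.

Lemma cvg_binR_next (F : nat -> R) d (l : R) :
  (fun n => F n / binR d n) @ \oo --> l -> (fun n => F n / binR d.+1 n) @ \oo --> (0 : R).
Proof.
move=> Fl; apply: (@cvgn_near (fun n => F n / binR d n * (binR d n / binR d.+1 n))).
  near=> n; have dn : (d.+1 <= n)%N by near: n; exists d.+1.
  have := @binR_gt0 d.+1 n dn; have := @binR_gt0 d n (ltnW dn).
  by move: (binR d n) (binR d.+1 n) => x y *; field; rewrite !gt_eqF.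
by rewrite -(mulr0 l); apply: cvgM Fl _; apply: binR_div_next.
Unshelve. all: by end_near. Qed.

Lemma cvg_binR_lt (F : nat -> R) d d' (l : R) : (d < d')%N ->
  (fun n => F n / binR d n) @ \oo --> l -> (fun n => F n / binR d' n) @ \oo --> (0 : R).
Proof.
move=> /subnKC <- Fl; elim: (d' - d.+1)%N => [|k IHk].
  by rewrite addn0; apply: cvg_binR_next Fl.
by rewrite addnS; apply: cvg_binR_next IHk.
Qed.

Lemma cvg_binR_shift (F : nat -> R) d (l : R) :
  (fun n => F n.+1 / binR d n) @ \oo --> l -> (fun n => F n / binR d n) @ \oo --> l.
Proof.
move=> Fl; rewrite -cvg_shiftS.
apply: (@cvgn_near (fun n => F n.+1 / binR d n * (binR d n / binR d n.+1))).
  near=> n; have dn : (d <= n)%N by near: n; exists d.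
  have := @binR_gt0 d n dn; have := @binR_gt0 d n.+1 (leqW dn).
  by rewrite /=; move: (binR d n) (binR d n.+1) => x y *; field; rewrite !gt_eqF.
by rewrite -[X in _ --> X]mulr1; apply: cvgM Fl _; apply: binR_div_succ.
Unshelve. all: by end_near. Qed.

Lemma leq_sub_binS n d : (n - d <= 'C(n, d.+1))%N.
Proof.
elim: n => // n IHn; rewrite binS; have [dn|nd] := leqP d n; last lia.
by have : (0 < 'C(n, d))%N by [rewrite bin_gt0]; lia.
Qed.

Lemma binR_pinfty d : binR d.+1 @ \oo --> +oo.
Proof.
apply/cvgryPge => A; near=> n.
have dn : (d < n)%N by near: n; exists d.+1.
apply: (@le_trans _ _ (n - d)%:R).
  have : A + d%:R <= n%:R by near: n; apply: nbhs_infty_ger.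
  by rewrite natrB ?(ltnW dn) //; lra.
by rewrite /binR ler_nat leq_sub_binS.
Unshelve. all: by end_near. Qed.

Lemma cvg_binR_sum (F G : nat -> R) d (l : R) :
  (forall n, F n.+1 = F n + G n) ->
  (fun n => G n / binR d n) @ \oo --> l ->
  (fun n => F n / binR d.+1 n) @ \oo --> l.
Proof.
move=> FG Gl; apply: stolz_cesaro; first exact: binR_pinfty.
move=> e e0; near=> n.
have dn : (d <= n)%N by near: n; exists d.
have b0 := @binR_gt0 d n dn.
have -> : binR d.+1 n.+1 - binR d.+1 n = binR d n.
  by rewrite /binR binS natrD addrC addKr.
rewrite FG (addrC (F n)) addrK -ler_pdivrMr // -[X in _ / X](gtr0_norm b0) -normfV -normrM.
rewrite mulrBl mulfK ?gt_eqF // distrC.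
by near: n; move/cvgrPdist_le: Gl; apply.
Unshelve. all: by end_near. Qed.

Section Polynomial_growth.
Context {T : finType}.

(** One degree [d] serves all [v]. A single [al v] may vanish, but the positive sum makes [d] the
    exact degree of the total. *)
Definition poly_growth (F : nat -> T -> nat) := exists d (al : T -> R),
  [/\ forall v, (fun n => (F n v)%:R / binR d n) @ \oo --> al v,
      forall v, 0 <= al v & 0 < \sum_v al v].

(** The larger degree wins; in equal degrees the coefficients add, and being nonnegative they cannot
    cancel. *)
Lemma poly_growthD F G : poly_growth F -> poly_growth G ->
  poly_growth (fun n v => (F n v + G n v)%N).
Proof.
move=> [d [al [Fal al0 sal]]] [d' [al' [Gal al'0 sal']]].
wlog dd' : d d' al al' F G Fal Gal al0 al'0 sal sal' / (d <= d')%N.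
  move=> H; have [dd'|/ltnW dd'] := leqP d d'; first exact: (H d d' al al').
  under boolp.eq_fun => n do under boolp.eq_fun => v do rewrite addnC.
  exact: (H d' d al' al).
have lim v (c c' : R) : (fun n => (F n v)%:R / binR d' n) @ \oo --> c ->
    (fun n => (G n v)%:R / binR d' n) @ \oo --> c' ->
    (fun n => (F n v + G n v)%:R / binR d' n) @ \oo --> (c + c').
  move=> Fc Gc; under boolp.eq_fun => n do rewrite natrD mulrDl.
  exact: cvgD.
move: dd'; rewrite leq_eqVlt => /predU1P[dd'|dd'].
  subst d'; exists d, (fun v => al v + al' v); split => [v|v|].
  - exact: lim.
  - exact: addr_ge0.
  - by rewrite big_split addr_gt0.
exists d', al'; split => // v; rewrite -[al' v]add0r.
by apply: lim => //; apply: cvg_binR_lt (Fal v).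
Qed.

Lemma poly_growth_sum (s : seq nat) (F : nat -> nat -> T -> nat) :
  s != [::] -> (forall j, j \in s -> poly_growth (F j)) ->
  poly_growth (fun n v => (\sum_(j <- s) F j n v)%N).
Proof.
elim: s => // j s IHs _ Fs.
have Fj : poly_growth (F j) by apply: Fs; rewrite mem_head.
have [->|s0] := eqVneq s [::].
  by under boolp.eq_fun => n do under boolp.eq_fun => v do rewrite big_seq1.
under boolp.eq_fun => n do under boolp.eq_fun => v do rewrite big_cons.
apply: poly_growthD => //; apply: IHs => // k ks.
by apply: Fs; rewrite in_cons ks orbT.
Qed.

(** The case of diagonal entry [0] in the triangular recurrence: the degree is unchanged. *)
Lemma poly_growth_shift F G : (forall n v, F n.+1 v = G n v) ->
  poly_growth G -> poly_growth F.
Proof.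
move=> FG [d [al [Gal al0 sal]]]; exists d, al; split => // v.
apply: (cvg_binR_shift (F := fun n => (F n v)%:R)).
under boolp.eq_fun => n do rewrite FG.
exact: Gal.
Qed.

(** The case of diagonal entry [1]: the degree goes up by one. *)
Lemma poly_growth_series F G : (forall n v, F n.+1 v = (F n v + G n v)%N) ->
  poly_growth G -> poly_growth F.
Proof.
move=> FG [d [al [Gal al0 sal]]]; exists d.+1, al; split => // v.
apply: (cvg_binR_sum (F := fun n => (F n v)%:R)) (Gal v) => n.
by rewrite FG natrD.
Qed.

Lemma poly_growth_cst (x : T) (F : nat -> T -> nat) :
  (forall n v, F n v = (x == v)) -> poly_growth F.
Proof.
move=> Fx; exists 0%N, (fun v => (x == v)%:R); split => [v|v|].
- under boolp.eq_fun => n do rewrite Fx /binR bin0 divr1.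
  exact: cvg_cst.
- exact: ler0n.
- rewrite (bigD1 x) //= eqxx big1 ?addr0 ?ltr01 // => v.
  by rewrite eq_sym => /negbTE ->.
Qed.

End Polynomial_growth.
End BinomialGrowth.

(** * Polynomial growth of block counts *)

Section BlockGrowth.
Context {R : realType} (T : finType) (W : nat -> T) (S : nat -> nat).
Hypothesis S_lt : forall i, S i < S i.+1.
Hypothesis S_det : forall i j, W i = W j -> forall m (f : T -> nat),
  \sum_(iter m S i <= k < iter m S i.+1) f (W k) =
  \sum_(iter m S j <= k < iter m S j.+1) f (W k).

Let bc := block_count W S.

Let reach i := [pred y | `[< exists m, 0 < bc m i y >]].

(* By induction on the number of types reachable from [W i]: the first hypothesis
   says that a recurrent type returns in one step, the second that it does so
   only once, so all other types in the block reach strictly fewer types. *)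
Lemma block_count_poly_growth :
  (forall i t, 0 < t -> 0 < bc t i (W i) -> 0 < bc 1 i (W i)) ->
  (forall i t, bc t i (W i) <= 1) ->
  forall i, poly_growth (R := R) (fun n => bc n i).
Proof.
move=> period1 simple i.
have [n] := ubnP #|reach i|; elim: n => // n IHn in i * => rank_i.
pose s := [seq j <- index_iota (S i) (S i.+1) | W j != W i].
have lower j : j \in s -> poly_growth (R := R) (fun n => bc n j).
  rewrite mem_filter mem_index_iota => /andP[Wji ij].
  have ij1 : 0 < bc 1 i (W j) by apply/block_count_gt0P; exists j.
  apply: IHn; rewrite -ltnS; apply: leq_trans rank_i; rewrite ltnS; apply: proper_card.
  apply/properP; split.
    apply/fintype.subsetP => y; rewrite !inE => -[m jy].
    by exists (m + 1); apply: (block_count_trans S_lt S_det) ij1 jy.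
  exists (W i); rewrite inE; first by exists 0; rewrite /bc block_count0 eqxx.
  (* If [W j] led back to [W i] in [m] steps, then [W i] would return twice in [m + 1] steps: once
     through [j], and once through a position [k] of the one-step block with [W k = W i]. *)
  apply/negP; rewrite ?inE => -[m ji].
  have im : 0 < bc (m + 1) i (W i) by apply: (block_count_trans S_lt S_det) ij1 ji.
  have i1 : 0 < bc 1 i (W i) by apply: period1 im; rewrite addn1.
  have /block_count_gt0P[k ik Wk] := i1.
  suff : 1 < bc (m + 1) i (W i) by rewrite ltnNge simple.
  have im' : 0 < bc m i (W i).
    by move: (block_count_cycle S_lt S_det m i1); rewrite muln1.
  have kj : k != j by apply: contraNneq Wji => <-; rewrite Wk.
  rewrite /bc (block_countD _ S_lt) /= (bigD1_seq j) ?mem_index_iota ?iota_uniq //=.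
  have jk_gt0 : 0 < \sum_(k <- index_iota (S i) (S i.+1) | k != j) bc m k (W i).
    rewrite lt0n sum_nat_seq_neq0; apply/hasP; exists k; first by rewrite mem_index_iota.
    by rewrite kj -lt0n /bc (block_count_eq S_det _ _ Wk).
  by rewrite -[2]/(1 + 1) leq_add.
pose c := bc 1 i (W i).
(* The triangular recurrence: positions of the one-step block carrying [W i] give the diagonal entry
   [c], the others form [s]. *)
have rec n' v : bc n'.+1 i v = c * bc n' i v + \sum_(j <- s) bc n' j v.
  rewrite /bc -addn1 (block_countD _ S_lt) /= (bigID (fun j => W j == W i)) /=.
  rewrite [in RHS]big_filter; congr (_ + _).
  have -> : c = \sum_(S i <= j < S i.+1) (W j == W i) by [].
  rewrite big_distrl /= big_mkcond /=; apply: eq_bigr => j _.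
  by case: eqP => [Wj|]; rewrite ?mul1n // (block_count_eq S_det _ _ Wj).
(* If [s] is empty, the nonempty one-step block is a single copy of [W i], and the counts stay
   constant. *)
have [s0|s0] := eqVneq s [::].
  have c1 : c = 1.
    apply/eqP; rewrite eqn_leq simple; apply/block_count_gt0P; exists (S i).
      by rewrite /= leqnn S_lt.
    apply/eqP; apply: contraT => WSi; suff : S i \in s by rewrite s0.
    by rewrite mem_filter WSi mem_index_iota leqnn S_lt.
  apply: (@poly_growth_cst _ _ (W i)) => n' v.
  elim: n' => [|n' IH]; first by rewrite /bc block_count0.
  by rewrite rec s0 big_nil addn0 c1 mul1n.
have := poly_growth_sum s0 lower.
have : c <= 1 by apply: simple.
rewrite leq_eqVlt ltnS leqn0 => /orP[/eqP c1|/eqP c0].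
  by apply: poly_growth_series => n' v; rewrite rec c1 mul1n.
by apply: poly_growth_shift => n' v; rewrite rec c0 mul0n.
Qed.
End BlockGrowth.

Lemma block_count_iter (T : finType) (W : nat -> T) (S : nat -> nat) p n i v :
  block_count W (iter p S) n i v = block_count W S (n * p) i v.
Proof. by rewrite /block_count !iterM. Qed.

(** Replacing [S] by [iter p S], with [p] a common return time, makes every recurrent letter return
    in one step. The slope [3 / 2], being less than [2], excludes double returns at every time. *)
Lemma subexponential_poly_growth (R : realType) (T : finType) (W : nat -> T)
    (S : nat -> nat) :
  (forall i, S i < S i.+1) ->
  (forall i j, W i = W j -> forall m (f : T -> nat),
    \sum_(iter m S i <= k < iter m S i.+1) f (W k) =
    \sum_(iter m S j <= k < iter m S j.+1) f (W k)) ->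
  (forall t, exists K, forall n, 2 * iter t S n <= 3 * n + K) ->
  exists2 p, 0 < p & forall i,
    poly_growth (R := R) (fun n => block_count W S (n * p) i).
Proof.
move=> S_lt S_det S_slow; have [p p_gt0 pP] := recurrence_period S_lt S_det.
exists p => // i.
have E : (fun n => block_count W S (n * p) i) = (fun n => block_count W (iter p S) n i).
  by apply/funext => n; apply/funext => v; rewrite block_count_iter.
rewrite E; apply: block_count_poly_growth => [j|j k jk m f|j t t_gt0|j t].
- exact: ltn_homo_iter.
- by rewrite -!iterM; apply: S_det.
- by rewrite !block_count_iter mul1n; apply: pP; rewrite muln_gt0 t_gt0.
- have [K HK] := S_slow (t * p).
  by rewrite block_count_iter; apply: (block_count_le1 S_lt S_det HK).
Qed.

(** * Frequencies from block counts *)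

Section Frequencies.
Local Open Scope ring_scope.
Local Open Scope classical_set_scope.
Context {R : realType}.

Lemma ex_between (L : nat -> nat) n0 N : (forall n, L n < L n.+1)%N ->
  (L n0 <= N)%N -> exists2 n, (n0 <= n)%N & (L n <= N < L n.+1)%N.
Proof.
move=> L_lt; elim: N => [|N IHN] LN.
  by exists n0; rewrite // LN (leq_ltn_trans _ (L_lt n0)).
move: LN; rewrite leq_eqVlt => /predU1P[LN|].
  by exists n0 => //; rewrite LN leqnn -LN L_lt.
rewrite ltnS => /IHN [n n0n /andP[Ln LSn]].
have [h|h] := ltnP N.+1 (L n.+1); first by exists n; rewrite // h leqW.
have E : L n.+1 = N.+1 by lia.
by exists n.+1; [exact: leqW|rewrite E leqnn -E L_lt].
Qed.

(** Between [L n] and [L n.+1] both the count and the length vary by at most [L n.+1 - L n], which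
    is small relative to [L n]. *)
Lemma ratio_interp (N L : nat -> nat) (l e d : R) :
  N 0%N = 0%N -> (forall n, N n <= N n.+1 <= (N n).+1)%N ->
  (forall n, L n < L n.+1)%N ->
  (fun n => (L n.+1)%:R / (L n)%:R : R) @ \oo --> (1 : R) -> 0 < d ->
  (\forall n \near \oo, `|l - (N (L n))%:R / (L n)%:R| <= e) ->
  \forall n \near \oo, `|l - (N n)%:R / n%:R| <= e + d.
Proof.
move=> N0 N_le L_lt L1 d0 [n1 _ n1P].
have [n2 _ n2P] : \forall n \near \oo, (L n.+1)%:R / (L n)%:R <= 1 + d / 2.
  by apply: cvgr_le L1 _ _; lra.
(* The successor forces [n] to be positive, hence [L n] as well. *)
pose n0 := (maxn n1 n2).+1; exists (L n0) => // m /= /(ex_between L_lt)[n n0n /andP[Lm mL]].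
have L0 : (0 < L n)%N.
  have : (n0 <= n)%N by []; case: (n) => // n' _; exact: leq_ltn_trans (L_lt n').
have := n1P n; have := n2P n; rewrite /=.
move=> /(_ ltac:(lia)); set x := (L n)%:R : R; set x' := (L n.+1)%:R : R => x'x.
move=> /(_ ltac:(lia)) nx.
have N_len k : (N k <= k)%N by elim: k => [|k IHk]; [rewrite N0|have := N_le k; lia].
have N_mono k : (N (L n) <= N (L n + k) <= N (L n) + k)%N.
  elim: k => [|k IHk]; first by rewrite !addn0 leqnn.
  by rewrite addnS; have := N_le (L n + k)%N; lia.
have := N_mono (m - L n)%N; rewrite subnKC // => /andP[Nm1 Nm2].
have xpos : 0 < x by rewrite ltr0n.
have mpos : 0 < m%:R :> R by rewrite ltr0n; lia.
have xm : x <= m%:R by rewrite ler_nat.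
have mx' : m%:R <= x' by rewrite ler_nat ltnW.
have {}x'x : x' - x <= d / 2 * x by move: x'x; rewrite ler_pdivrMr //; lra.
have y1 : (N (L n))%:R <= (N m)%:R :> R by rewrite ler_nat.
have y2 : (N m)%:R <= (N (L n))%:R + (m%:R - x) :> R by rewrite -natrB // -natrD ler_nat.
have y3 : (N (L n))%:R <= x by rewrite ler_nat.
have y0 : 0 <= (N (L n))%:R :> R by [].
move: nx y0 y1 y2 y3; set y := (N (L n))%:R; set z := (N m)%:R => nx y0 y1 y2 y3.
suff : `|y / x - z / m%:R| <= d.
  move: nx; rewrite !ler_norml => /andP[? ?] /andP[? ?]; apply/andP; split; lra.
move: (m%:R : R) mpos xm mx' y2 => M mpos xm mx' y2.
have -> : y / x - z / M = (y * M - z * x) / (x * M).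
  by field; rewrite !gt_eqF.
rewrite normrM normfV (gtr0_norm (mulr_gt0 xpos mpos)) ler_pdivrMr ?mulr_gt0 //.
by rewrite ler_norml; apply/andP; split; nra.
Qed.

(** Factor the ratio for [m.+1] through [S n], which tends to infinity. *)
Lemma cvg_iter_ratio (S : nat -> nat) (lam : R) m :
  (forall i, S i < S i.+1)%N ->
  (fun n => (S n)%:R / n%:R) @ \oo --> lam ->
  (fun n => (iter m S n)%:R / n%:R) @ \oo --> lam ^+ m.
Proof.
move=> S_lt Sl; elim: m => [|m IHm].
  apply: (@cvgn_near _ (fun=> 1)); last by rewrite expr0; apply: cvg_cst.
  near=> n; have n0 : (0 < n)%N by near: n; exists 1%N.
  by rewrite /= divff // pnatr_eq0 -lt0n.
apply: (@cvgn_near _ (fun n => (iter m S (S n))%:R / (S n)%:R * ((S n)%:R / n%:R))).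
  near=> n; have n0 : (0 < n)%N by near: n; exists 1%N.
  rewrite iterSr mulrA mulfVK // pnatr_eq0 -lt0n.
  exact: leq_trans n0 (leq_iter_id 1 n S_lt).
rewrite exprSr; apply: cvgM => //.
have Soo : S @ \oo --> \oo.
  apply/cvgnyPge => A; exists A => // n /= An.
  exact: leq_trans An (leq_iter_id 1 n S_lt).
exact: (cvg_comp _ _ Soo IHm).
Unshelve. all: by end_near. Qed.

(** The mean of [g] along [w] is a finite linear combination of letter frequencies. *)
Lemma cvg_weighted_sum (A : finType) (w : nat -> A) (g : A -> nat) :
  (forall a, cvgn (fun n => (\sum_(0 <= i < n) (w i == a))%:R / n%:R : R)) ->
  cvgn (fun n => (\sum_(0 <= i < n) g (w i))%:R / n%:R : R).
Proof.
move=> w_freq.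
have E n : (\sum_(0 <= i < n) g (w i))%:R / n%:R =
    \sum_a (g a)%:R * ((\sum_(0 <= i < n) (w i == a))%:R / n%:R) :> R.
  under [RHS]eq_bigr do rewrite mulrA -natrM.
  rewrite -mulr_suml -natr_sum; congr (_%:R / _).
  under [RHS]eq_bigr do rewrite big_distrr /=.
  rewrite exchange_big; apply: eq_bigr => i _; rewrite /= (bigD1 (w i)) //= eqxx muln1.
  by rewrite big1 ?addn0 // => a; rewrite eq_sym => /negbTE ->; rewrite muln0.
under boolp.eq_fun => n do rewrite E.
apply/cvg_ex; exists (\sum_a (g a)%:R * lim ((fun n => (\sum_(0 <= i < n) (w i == a))%:R / n%:R : R) @ \oo)).
apply: cvg_big => [|a _]; first exact: add_continuous.
by apply: cvgMl_tmp; apply: w_freq.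
Qed.

Lemma partial_count_step (X : nat -> bool) n :
  (\sum_(0 <= j < n) X j <= \sum_(0 <= j < n.+1) X j <= (\sum_(0 <= j < n) X j).+1)%N.
Proof. by rewrite big_nat_recr //=; case: (X n); lia. Qed.

Lemma cvg_succ_ratio (L : nat -> nat) (c : R) : 0 < c ->
  (fun n => (L n)%:R / n%:R) @ \oo --> c ->
  (fun n => (L n.+1)%:R / (L n)%:R : R) @ \oo --> (1 : R).
Proof.
move=> c0 Lc.
have h1 : (fun n => 1 + n%:R^-1 : R) @ \oo --> (1 : R).
  rewrite -[X in _ --> X]addr0; apply: cvgD; first exact: cvg_cst.
  rewrite -cvg_shiftS; exact: cvg_harmonic.
have LSc : (fun n => (L n.+1)%:R / n.+1%:R) @ \oo --> c by move: Lc; rewrite -cvg_shiftS.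
rewrite -[X in _ --> X](mulfV (lt0r_neq0 c0)) -[X in _ --> X](mulr1).
apply: cvg_trans (cvgM (cvgM LSc (cvgV (lt0r_neq0 c0) Lc)) h1).
apply: near_eq_cvg; near=> n.
have n0 : 0 < n%:R :> R by rewrite ltr0n; near: n; exists 1%N.
have Ln0 : (L n)%:R != 0 :> R.
  have : 0 < (L n)%:R / n%:R :> R by near: n; apply: cvgr_gt Lc _ c0.
  by apply: contraTneq => ->; rewrite mul0r ltxx.
rewrite /= -[n.+1]addn1 natrD; field.
by rewrite Ln0 /= !gt_eqF ?addr_gt0.
Unshelve. all: by end_near. Qed.

(** Here [l] may depend on [e]: the sequence is Cauchy, and completeness supplies the limit. *)
Lemma cvg_of_approx (u : nat -> R) :
  (forall e : R, 0 < e -> exists l, \forall n \near \oo, `|l - u n| <= e) -> cvgn u.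
Proof.
move=> u_approx; apply/cauchy_cvgP/cauchy_exP => e e0.
have [|l lP] := u_approx (e / 2); first lra.
exists l; rewrite -ball_normE; apply: filterS lP => n /=; lra.
Qed.

(** Replacing each block count by a value depending only on the letter costs at most [k] per block,
    a relative error of about [k / lam ^+ m]. *)
Lemma freq_of_expanding (A : finType) (w : nat -> A) (S : nat -> nat) (lam : R)
    (X : nat -> bool) (k : nat) :
  (forall i, S i < S i.+1)%N -> S 0%N = 0%N ->
  (fun n => (S n)%:R / n%:R) @ \oo --> lam -> 1 < lam ->
  (forall a, cvgn (fun n => (\sum_(0 <= i < n) (w i == a))%:R / n%:R : R)) ->
  (forall m i j, w i = w j ->
    \sum_(iter m S i <= r < iter m S i.+1) X r <=
    \sum_(iter m S j <= r < iter m S j.+1) X r + k)%N ->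
  cvgn (fun n => (\sum_(0 <= j < n) X j)%:R / n%:R : R).
Proof.
move=> S_lt S0 Slam lam1 w_freq Xk; apply: cvg_of_approx => e e0.
have [m mP] : exists m, k%:R / lam ^+ m <= e / 4 :> R.
  have : (fun m => k%:R * lam^-1 ^+ m : R) @ \oo --> (0 : R).
    rewrite -(mulr0 (k%:R : R)); apply: cvgMl_tmp; apply: cvg_expr.
    by rewrite normfV gtr0_norm ?invf_lt1 //; lra.
  move=> /cvgr_le /(_ (e / 4))[|m _ mP]; first lra.
  by exists m; rewrite -exprVn; apply: mP => /=.
set L := iter m S; set h := fun i => (\sum_(L i <= r < L i.+1) X r)%N.
(* For each letter, [g] takes the count in the block of one of its occurrences, and [0] for letters
   that do not occur. *)
have [g gP] : exists g : A -> nat, forall i, (h i <= g (w i) + k /\ g (w i) <= h i + k)%N.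
  suff /choice[g gP] : forall a, exists y, forall i, w i = a -> (h i <= y + k /\ y <= h i + k)%N.
    by exists g => i; apply: gP.
  move=> a; have [[i <-]|noa] := pselect (exists i, w i = a).
    by exists (h i) => j ji; split; apply: Xk.
  by exists 0%N => i ia; case: noa; exists i.
have lamm : 0 < lam ^+ m by rewrite exprn_gt0 //; lra.
have Llam := cvg_iter_ratio (m := m) S_lt Slam.
have L0 : L 0%N = 0%N by rewrite /L; elim: (m) => //= m' ->.
have L_lt i : (L i < L i.+1)%N by apply: ltn_homo_iter.
have sumh n : (\sum_(0 <= j < L n) X j = \sum_(0 <= i < n) h i)%N.
  by rewrite -(@big_nat_blocks L _ 0%N) ?L0 //; apply: leq_homo_iter.
have bound n : `|(\sum_(0 <= i < n) g (w i))%:R - (\sum_(0 <= j < L n) X j)%:R| <= n%:R * k%:R :> R.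
  have [b1 b2] : (\sum_(0 <= i < n) h i <= \sum_(0 <= i < n) g (w i) + n * k /\
     \sum_(0 <= i < n) g (w i) <= \sum_(0 <= i < n) h i + n * k)%N.
    elim: n => [|n [IH1 IH2]]; first by rewrite !big_geq.
    by rewrite !big_nat_recr //= mulSn; have := gP n; lia.
  rewrite sumh; move: b1 b2; rewrite -!(ler_nat R) !natrD natrM ler_norml => ? ?.
  by apply/andP; split; lra.
have /cvg_ex[gam gamP] := cvg_weighted_sum (g := g) w_freq.
have nLlam : (fun n => k%:R * ((L n)%:R / n%:R)^-1 : R) @ \oo --> k%:R / lam ^+ m.
  by apply: cvgMl_tmp; apply: cvgV => //; rewrite gt_eqF.
have gL : (fun n => (\sum_(0 <= i < n) g (w i))%:R / n%:R * ((L n)%:R / n%:R)^-1) @ \oo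
    --> gam / lam ^+ m.
  by apply: cvgM => //; apply: cvgV => //; rewrite gt_eqF.
(* Error budget: [e / 4] for interpolating between block ends, [e / 4] for the convergence of the
   averages of [g], and [e / 2] for the block errors, whose bound has a limit of at most [e / 4]. *)
exists (gam / lam ^+ m); have -> : e = 3 * e / 4 + e / 4 by lra.
apply: (@ratio_interp (fun n => \sum_(0 <= j < n) X j)%N L) => //.
- by rewrite big_geq.
- exact: partial_count_step.
- exact: cvg_succ_ratio Llam.
- by lra.
near=> n.
have n0 : 0 < n%:R :> R by rewrite ltr0n; near: n; exists 1%N.
have Ln0 : 0 < (L n)%:R :> R.
  have : 0 < (L n)%:R / n%:R :> R by near: n; apply: cvgr_gt Llam _ lamm.
  by rewrite pmulr_lgt0 // invr_gt0.
have b1 : k%:R * ((L n)%:R / n%:R)^-1 <= e / 2 :> R.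
  by near: n; apply: cvgr_le nLlam _ _; lra.
have b2 : `|gam / lam ^+ m - (\sum_(0 <= i < n) g (w i))%:R / n%:R * ((L n)%:R / n%:R)^-1| <= e / 4.
  by near: n; move/cvgrPdist_le: gL; apply; lra.
apply: le_trans (ler_distD ((\sum_(0 <= i < n) g (w i))%:R / n%:R * ((L n)%:R / n%:R)^-1) _ _) _.
have -> : 3 * e / 4 = e / 4 + e / 2 by lra.
apply: lerD b2 _; apply: le_trans b1.
have -> : (\sum_(0 <= i < n) g (w i))%:R / n%:R * ((L n)%:R / n%:R)^-1 - (\sum_(0 <= j < L n) X j)%:R / (L n)%:R
  = ((\sum_(0 <= i < n) g (w i))%:R - (\sum_(0 <= j < L n) X j)%:R) / (L n)%:R :> R.
  move: (_%:R : R) (_%:R : R) (_%:R : R) (_%:R : R) n0 Ln0 => x y z t y0 t0.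
  by field; rewrite !gt_eqF.
rewrite invf_div mulrA normrM normfV (gtr0_norm Ln0) ler_pM2r ?invr_gt0 //.
by rewrite mulrC; apply: bound.
Unshelve. all: by end_near. Qed.

Lemma freq_of_subexponential (T : finType) (W : nat -> T) (S : nat -> nat) :
  (forall i, S i < S i.+1)%N -> S 0%N = 0%N -> (1 < S 1)%N ->
  (forall i j, W i = W j -> forall m (f : T -> nat),
    \sum_(iter m S i <= k < iter m S i.+1) f (W k) =
    \sum_(iter m S j <= k < iter m S j.+1) f (W k))%N ->
  (fun n => (S n)%:R / n%:R : R) @ \oo --> (1 : R) ->
  forall v, cvgn (fun n => (\sum_(0 <= i < n) (W i == v))%:R / n%:R : R).
Proof.
move=> S_lt S0 S1 S_det Slim.
have St t : (fun n => (iter t S n)%:R / n%:R : R) @ \oo --> (1 : R).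
  by rewrite -[X in _ --> X](expr1n R t); apply: cvg_iter_ratio.
(* The ratio is eventually at most [3 / 2]; [K] covers the finitely many earlier [n]. *)
have slow t : exists K, forall n, (2 * iter t S n <= 3 * n + K)%N.
  have [|N _ NP] := cvgr_le _ (St t) (3 / 2); first lra.
  exists (2 * iter t S N)%N => n; have [nN|Nn] := leqP n N.
    by apply: leq_trans (leq_addl _ _); rewrite leq_mul2l /= leq_homo_iter.
  apply: leq_trans (leq_addr _ _); rewrite -(ler_nat R) !natrM.
  have := NP n (ltnW Nn); rewrite /= ler_pdivrMr ?ltr0n; first lra.
  exact: leq_ltn_trans Nn.
have [p p_gt0 /(_ 0%N)] := subexponential_poly_growth R S_lt S_det slow.
case=> d [al [alP al0 sal]] v.
(* As [S] fixes [0], the iterated block of position [0] is the prefix of length [L n]. The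
   hypothesis [1 < S 1] makes [L] strictly increasing. *)
pose L n := iter (n * p) S 1.
have iS0 m : iter m S 0%N = 0%N by elim: m => //= m ->.
have cntL u n : block_count W S (n * p) 0 u = (\sum_(0 <= j < L n) (W j == u))%N.
  by rewrite /block_count iS0.
have LE n : (L n)%:R = \sum_u (block_count W S (n * p) 0 u)%:R :> R.
  by rewrite -natr_sum sum_block_count iS0 subn0.
have S_gt i : (0 < i -> i < S i)%N.
  by elim: i => // -[//|i] IH _; apply: leq_ltn_trans (IH _) (S_lt _).
have LS n : L n.+1 = iter p S (L n) by rewrite /L mulSn iterD.
have L_pos n : (0 < L n)%N.
  by rewrite /L; apply: leq_iter_id.
have L_lt n : (L n < L n.+1)%N.
  rewrite LS -(prednK p_gt0) iterS.
  apply: leq_ltn_trans (leq_iter_id p.-1 _ S_lt) (S_gt _ _).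
  exact: leq_trans (L_pos n) (leq_iter_id _ _ S_lt).
have Loo : L @ \oo --> \oo.
  apply/cvgnyPge => A; exists A => // n /= An; apply: leq_trans An _.
  by elim: n => // n IHn; apply: leq_ltn_trans IHn (L_lt n).
have Llim : (fun n => (L n)%:R / binR d n : R) @ \oo --> \sum_u al u.
  under boolp.eq_fun => n do rewrite LE mulr_suml.
  by apply: cvg_big => [|u _]; [exact: add_continuous|exact: alP].
(* Along [L], count and length are measured against the same [binR d], so the density tends to the
   quotient of their coefficients. *)
apply/cvg_ex; exists (al v / \sum_u al u); apply/cvgrPdist_le => e e0.
rewrite (_ : e = e / 2 + e / 2); last lra.
apply: (@ratio_interp (fun n => \sum_(0 <= j < n) (W j == v))%N L) => //.
- by rewrite big_geq.
- exact: partial_count_step.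
- by under boolp.eq_fun => n do rewrite LS; apply: (cvg_comp _ _ Loo (St p)).
- by lra.
suff /cvgrPdist_le : (fun n => (\sum_(0 <= j < L n) (W j == v))%:R / (L n)%:R : R) @ \oo
    --> al v / \sum_u al u by apply; lra.
apply: cvg_trans (cvgM (alP v) (cvgV (lt0r_neq0 sal) Llim)).
apply: near_eq_cvg; near=> n.
have dn : (d <= n)%N by near: n; exists d.
have L0 : (L n)%:R != 0 :> R by rewrite pnatr_eq0 -lt0n.
rewrite /= cntL; have := @binR_gt0 R d n dn.
move: (binR d n) (_%:R : R) (_%:R : R) L0 => x y z z0 x0.
by field; rewrite z0 gt_eqF.
Unshelve. all: by end_near. Qed.

End Frequencies.

(** * Fixed points of morphisms *)

Section Words.
Context (A : finType) (phi : A -> seq A) (b : A) (u : seq A) (w : nat -> A).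
Hypothesis phi_gt0 : non_erasing phi.
Hypothesis phi_b : phi b = b :: u.
Hypothesis u_gt0 : 0 < size u.
Hypothesis w_lim : is_limit_of_iterates phi b w.

Definition segment a c : seq A := [seq w j | j <- index_iota a c].

Lemma size_segment a c : size (segment a c) = c - a.
Proof. by rewrite size_map size_iota. Qed.

Lemma nth_segment x a c j : j < c - a -> nth x (segment a c) j = w (a + j).
Proof. by move=> jc; rewrite (nth_map 0) ?size_iota // nth_iota. Qed.

Lemma segment_cat a c d : a <= c -> c <= d ->
  segment a d = segment a c ++ segment c d.
Proof.
move=> ac cd; rewrite /segment -map_cat /index_iota; congr map.
have -> : d - a = (c - a) + (d - c) by lia.
by rewrite iotaD subnKC.
Qed.

Lemma morph_ext_cat (s t : seq A) :
  morph_ext phi (s ++ t) = morph_ext phi s ++ morph_ext phi t.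
Proof. by rewrite /morph_ext map_cat flatten_cat. Qed.

Lemma leq_size_morph_ext (s : seq A) : size s <= size (morph_ext phi s).
Proof.
by elim: s => //= x s IHs; rewrite /morph_ext /= size_cat -add1n leq_add.
Qed.

(** This instantiates [S] of the preceding sections: the image of the letter [w n] starts here. *)
Definition image_pos n := \sum_(0 <= i < n) size (phi (w i)).

Lemma size_morph_ext_prefix n : size (morph_ext phi (segment 0 n)) = image_pos n.
Proof.
rewrite /morph_ext size_flatten /shape /image_pos -!map_comp sumnE !big_map.
by rewrite /index_iota subn0.
Qed.

Lemma image_pos_lt n : image_pos n < image_pos n.+1.
Proof. by rewrite /image_pos big_nat_recr //= -addn1 leq_add2l. Qed.

Let prefix i := iter i (morph_ext phi) [:: b].

Lemma prefix_segment i : prefix i = segment 0 (size (prefix i)).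
Proof.
apply: (@eq_from_nth _ b); first by rewrite size_segment subn0.
by move=> n ni; rewrite nth_segment ?subn0 // add0n (w_lim ni).
Qed.

Lemma ltn_size_prefix i : i < size (prefix i).
Proof.
suff [s [-> ?]] : exists s, prefix i = b :: s /\ i <= size s by [].
elim: i => [|i [s [IH Hs]]]; first by exists [::].
exists (u ++ morph_ext phi s); rewrite /prefix iterS -/(prefix i) IH /morph_ext /= phi_b.
by split => //; rewrite size_cat; move: (leq_size_morph_ext s); rewrite /morph_ext; lia.
Qed.

(** This is [phi w = w] on prefixes. Some iterate is longer than [n]; the next iterate is again a
    prefix of [w] and begins with the image of the first [n] letters. *)
Lemma morph_ext_prefix n : morph_ext phi (segment 0 n) = segment 0 (image_pos n).
Proof.
have ni := ltnW (ltn_size_prefix n); set m := size (prefix n) in ni.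
have E : morph_ext phi (segment 0 n) ++ morph_ext phi (segment n m) = prefix n.+1.
  by rewrite -morph_ext_cat -segment_cat // -prefix_segment.
have le : image_pos n <= size (prefix n.+1).
  by rewrite -E size_cat size_morph_ext_prefix leq_addr.
have := prefix_segment n.+1; rewrite -{1}E (segment_cat _ le) // => /eqP.
rewrite eqseq_cat; first by case/andP => /eqP.
by rewrite size_morph_ext_prefix size_segment subn0.
Qed.

Lemma image_posS_le a c : a <= c -> image_pos a <= image_pos c.
Proof. by apply: (homo_leq (@leqnn) (@leq_trans)) => k; apply: ltnW (image_pos_lt k). Qed.

Lemma morph_ext_segment a c : a <= c ->
  morph_ext phi (segment a c) = segment (image_pos a) (image_pos c).
Proof.
move=> ac; have := morph_ext_prefix c.
rewrite (segment_cat (leq0n a) ac) (segment_cat (leq0n _) (image_posS_le ac)).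
rewrite morph_ext_cat morph_ext_prefix => /eqP.
by rewrite eqseq_cat // => /andP[_ /eqP].
Qed.

Lemma iter_morph_ext_segment m a c : a <= c ->
  iter m (morph_ext phi) (segment a c) =
  segment (iter m image_pos a) (iter m image_pos c).
Proof.
move=> ac; elim: m => //= m ->; apply: morph_ext_segment.
exact: leq_homo_iter image_pos_lt _ _ ac.
Qed.

Lemma segment_image_eq m i j l : segment i (i + l) = segment j (j + l) ->
  segment (iter m image_pos i) (iter m image_pos (i + l)) =
  segment (iter m image_pos j) (iter m image_pos (j + l)).
Proof. by move=> ij; rewrite -!iter_morph_ext_segment ?leq_addr // ij. Qed.

(** * Windows of fixed length *)

Section Window.
Variable k : nat.

(** Finite functions make the windows a [finType], so that they can serve as the letters of [W]. *)
Definition window i : {ffun 'I_k -> A} := [ffun j : 'I_k => w (i + j)].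

Lemma window_segment_eq a c a' c' r : segment a c = segment a' c' ->
  r + k <= c - a -> window (a + r) = window (a' + r).
Proof.
move=> E rk; have := congr1 size E; rewrite !size_segment => sz.
apply/ffunP => j; rewrite !ffunE -!addnA.
have rj : r + j < c - a by have := ltn_ord j; lia.
by rewrite -(nth_segment b rj) E nth_segment // -sz.
Qed.

Lemma segment_window i j : window i = window j -> segment i (i + k) = segment j (j + k).
Proof.
move=> ij; apply: (@eq_from_nth _ b); rewrite !size_segment !addKn // => n nk.
rewrite !nth_segment ?addKn //.
by move/ffunP/(_ (Ordinal nk)): ij; rewrite !ffunE.
Qed.

Lemma big_nat_shift0 (f : nat -> nat) a c :
  \sum_(a <= r < c) f r = \sum_(0 <= r < c - a) f (a + r).
Proof.
by rewrite -{1}[a]add0n big_addn; apply: eq_bigr => r _; rewrite addnC.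
Qed.

(** A window starting in the image of [w i] runs at most [k.-1] positions past it. The images of the
    next [k.-1] letters are nonempty and cover this overhang, so the window at [i] determines
    everything read. *)
Lemma window_image_sum i j : 0 < k -> window i = window j ->
  forall m (f : {ffun 'I_k -> A} -> nat),
  \sum_(iter m image_pos i <= r < iter m image_pos i.+1) f (window r) =
  \sum_(iter m image_pos j <= r < iter m image_pos j.+1) f (window r).
Proof.
move=> k_gt0 ij m f; set S := iter m image_pos.
have S_lt : forall n, S n < S n.+1 by move=> n; apply: ltn_homo_iter image_pos_lt _ _ _.
have Ek : segment (S i) (S (i + k)) = segment (S j) (S (j + k)).
  exact: segment_image_eq (segment_window ij).
have E1 : segment (S i) (S i.+1) = segment (S j) (S j.+1).
  rewrite -(addn1 i) -(addn1 j); apply: segment_image_eq.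
  rewrite !addn1 /segment /index_iota !subSnn /=.
  by move/ffunP/(_ (Ordinal k_gt0)): ij; rewrite !ffunE !addn0 => ->.
have := congr1 size E1; rewrite !size_segment => sz.
rewrite [LHS]big_nat_shift0 [RHS]big_nat_shift0 -sz !big_mkord.
apply: eq_bigr => -[r /= rk] _; congr f; apply: window_segment_eq Ek _.
have : S i.+1 + k.-1 <= S (i + k).
  rewrite -(prednK k_gt0) addnS -addSn /=; elim: k.-1 => [|q IHq]; first by rewrite !addn0.
  by rewrite !addnS; apply: leq_ltn_trans IHq (S_lt _).
by lia.
Qed.

(** Equal letters have equal images, so windows lying inside the image agree; only those starting in
    its last [k] positions can differ. *)
Lemma window_count_image m i j v : w i = w j ->
  \sum_(iter m image_pos i <= r < iter m image_pos i.+1) (window r == v) <=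
  \sum_(iter m image_pos j <= r < iter m image_pos j.+1) (window r == v) + k.
Proof.
move=> ij.
have E1 : segment (iter m image_pos i) (iter m image_pos i.+1)
        = segment (iter m image_pos j) (iter m image_pos j.+1).
  rewrite -(addn1 i) -(addn1 j); apply: segment_image_eq.
  by rewrite !addn1 /segment /index_iota !subSnn /= ij.
have := congr1 size E1; rewrite !size_segment => sz.
rewrite big_nat_shift0 [X in _ <= X + _]big_nat_shift0 -sz; set n := _ - _ in sz E1 *.
rewrite (big_cat_nat (n := n - k)) ?leq_subr //= leq_add //.
  rewrite [leqRHS](big_cat_nat (n := n - k)) ?leq_subr //=.
  apply: leq_trans (leq_addr _ _); rewrite !big_mkord; apply: leq_sum => -[r /= rk] _.
  by rewrite (window_segment_eq E1) //; lia.
apply: leq_trans (_ : \sum_(n - k <= r < n) 1 <= _).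
  by apply: leq_sum => r _; apply: leq_b1.
by rewrite sum_nat_const_nat muln1; lia.
Qed.

End Window.

Lemma occurs_at_window v i :
  occurs_at w v i = (window (size v) i == [ffun j : 'I_(size v) => nth b v j]).
Proof.
apply/allP/eqP => [H|/ffunP H n].
  apply/ffunP => j; rewrite !ffunE (set_nth_default (w i)) //; apply/eqP/H.
  by rewrite mem_iota add0n ltn_ord.
rewrite mem_iota /= add0n => nv; have := H (Ordinal nv); rewrite !ffunE /= => ->.
by rewrite (set_nth_default (w i)).
Qed.

Lemma occ_countE v n : occ_count w v n = \sum_(0 <= i < n) occurs_at w v i.
Proof.
rewrite /occ_count -sum1_count big_mkcond /index_iota subn0.
by apply: eq_bigr => i _; case: occurs_at.
Qed.

End Words.

(** * Transfer to the limits of the statement, and conclusion *)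

Lemma cvgnP (K : realType) (x : nat -> K) : cvgn x <->
  exists l : K, forall e : K, (0 < e)%R ->
    exists N, forall n, N <= n -> (`|x n - l| < e)%R.
Proof.
split=> [/cvg_ex[l /cvgrPdist_lt xl]|[l xl]].
  exists l => e /xl [N _ NP]; exists N => n Nn; rewrite distrC; exact: NP.
apply/cvg_ex; exists l; apply/cvgrPdist_lt => e /xl [N NP].
by exists N => // n /= Nn; rewrite distrC; apply: NP.
Qed.

Lemma freq_existsP (A : finType) (w : nat -> A) (v : seq A) :
  freq_exists w v <->
  cvgn (fun n => (\sum_(0 <= i < n) occurs_at w v i)%:R / n%:R : (R : realType))%R.
Proof.
split=> [[l vl]|/cvgnP[l vl]].
  apply/cvgnP; exists l => e /RltP e0; have [N NP] := vl e e0.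
  by exists N => n /ssrnat.leP Nn; have := NP n Nn; rewrite !RealsE occ_countE => /RltP.
exists l => e /RltP e0; have [N NP] := vl e e0.
by exists N => n /ssrnat.leP Nn; rewrite !RealsE occ_countE; apply/RltP/NP.
Qed.

Theorem theorem1 (A : finType) (phi : A -> seq A) (b : A) (u : seq A)
    (w : nat -> A) :
  non_erasing phi ->
  phi b = b :: u ->
  0 < size u ->
  is_limit_of_iterates phi b w ->
  (forall a : A, freq_exists w [:: a]) ->
  forall v : seq A, is_factor w v -> freq_exists w v.
Proof.
move=> phi_gt0 phi_b u_gt0 w_lim letters v [v_gt0 _]; apply/freq_existsP.
set S := image_pos phi w.
have S_lt : forall i, S i < S i.+1 by apply: image_pos_lt.
have S0 : S 0 = 0 by rewrite /S /image_pos big_geq.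
have w0 : w 0 = b by apply: (w_lim 0 0).
have S1 : 1 < S 1 by rewrite /S /image_pos big_nat1 w0 phi_b.
have w_freq a : cvgn (fun n => (\sum_(0 <= i < n) (w i == a))%:R / n%:R : (R : realType))%R.
  have /freq_existsP := letters a.
  under boolp.eq_fun => n do under eq_bigr => i _ do rewrite /occurs_at /= addn0 andbT.
  by [].
(* The mean of the image lengths is [S n / n], so [lam] is the growth rate of [S]. *)
have /cvg_ex[lam lamP] := cvg_weighted_sum (g := fun a => size (phi a)) w_freq.
have lam1 : (1 <= lam)%R.
  apply: cvgr_to_ge lamP _; exists 1 => // n /= n_gt0.
  by rewrite ler_pdivlMr ?ltr0n // mul1r ler_nat; apply: (leq_iter_id 1 n S_lt).
under boolp.eq_fun => n do under eq_bigr => i _ do rewrite (occurs_at_window b).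
move: lam1; rewrite le_eqVlt => /predU1P[lam1|lam1]; last first.
  apply: (freq_of_expanding S_lt S0 lamP lam1 w_freq) => m i j ij.
  exact: (window_count_image phi_gt0 phi_b u_gt0 w_lim).
rewrite -lam1 in lamP.
apply: (freq_of_subexponential S_lt S0 S1 _ lamP) => i j ij.
exact: (window_image_sum phi_gt0 phi_b u_gt0 w_lim).
Qed.
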